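(* Let $(H,\langle\cdot,\cdot\rangle)$ be a real Hilbert space, let $\rho>0$ and let $\Phi:B_{\rho}\to H$ be a $C^1$ function, with Lipschitzian derivative, such that, for each $y\in B_{\rho}$, the function $x\mapsto \langle\Phi(x),x-y\rangle$ is weakly lower semicontinuous in $B_\rho$. Then the following assertions are equivalent: $(i)$ for each $r>0$ small enough (that is, there exists $r_0\in\,]0,\rho]$ such that for each $r\in\,]0,r_0]$), there exists a unique $x^*\in S_r$ such that $$\max\{\langle \Phi(x^* ),x^*-y\rangle,\ \langle \Phi(y),x^*-y\rangle\}< 0$$ for all $y\in B_r\setminus \{x^*\}$; $(ii)$ $\Phi(0)\neq 0$.
   Context: For $r>0$, $B_r=\{x\in H:\|x\|\leq r\}$ and $S_r=\{x\in H:\|x\|=r\}$. The derivative $\Phi':B_\rho\to\mathcal{L}(H)$ is Lipschitzian with respect to the operator norm on the space $\mathcal{L}(H)$ of bounded linear operators from $H$ to $H$. $]a,b]$ denotes the half-open interval $\{t: a<t\leq b\}$. *)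

(* Defs.v *)
From HB Require Import structures.
From mathcomp Require Import all_boot all_order all_algebra.
From mathcomp Require Import all_classical all_reals all_analysis.

Set Implicit Arguments.
Unset Strict Implicit.
Unset Printing Implicit Defensive.

Import Order.TTheory GRing.Theory Num.Theory.
Import numFieldNormedType.Exports.

Local Open Scope classical_set_scope.
Local Open Scope ring_scope.

(* A real Hilbert space is a complete normed module over the reals together
   with an inner product that induces its norm. *)
Definition hilbert_dot (R : realType) (H : completeNormedModType R)
    (dot : {dot H for idfun}) : Prop :=
  forall x : H, `|x| ^+ 2 = dot x x.

Definition Ball (R : realType) (H : normedModType R) (r : R) : set H :=
  [set x | `|x| <= r].

Definition Sphere (R : realType) (H : normedModType R) (r : R) : set H :=
  [set x | `|x| = r].

Arguments Ball {R} H r.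
Arguments Sphere {R} H r.

(* Meaningful for bounded linear A only: otherwise the set has no supremum and
   the value is junk. *)
Definition op_norm (R : realType) (V W : normedModType R) (A : V -> W) : R :=
  sup [set `|A x| | x in Ball V 1].

(* The increments are restricted to D, so that f needs no meaning outside D;
   this matters at the boundary points of D = Ball H rho, where it gives the
   one-sided notion.  When D is a ball of positive radius, df is unique. *)
Definition is_frechet_within (R : realType) (V W : normedModType R)
    (D : set V) (f : V -> W) (x : V) (df : {linear V -> W}) : Prop :=
  continuous df /\
  forall eps : R, 0 < eps -> \forall y \near within D (nbhs x),
    `|f y - f x - df (y - x)| <= eps * `|y - x|.

Definition C1_on (R : realType) (V W : normedModType R)
    (D : set V) (f : V -> W) (df : V -> {linear V -> W}) : Prop :=
  (forall x, D x -> is_frechet_within D f x (df x)) /\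
  (forall x, D x ->
     op_norm (df y \- df x) @[y --> within D (nbhs x)] --> (0 : R)).

Definition op_lipschitz_on (R : realType) (V W : normedModType R)
    (D : set V) (df : V -> {linear V -> W}) : Prop :=
  exists L : R, forall x y, D x -> D y ->
    op_norm (df x \- df y) <= L * `|x - y|.

(* The coarsest topology making every bounded linear functional continuous. *)
Definition weak (R : realType) (H : normedModType R) : topologicalType :=
  sup_topology (fun phi : {phi : {linear H -> R^o} | continuous phi} =>
    Topological.class (initial_topology (sval phi))).

(* Lower semicontinuity of the restriction of f to D, for the topology that the
   weak topology induces on D. *)
Definition weakly_lsc_on (R : realType) (H : normedModType R)
    (D : set H) (f : H -> R) : Prop :=
  @lower_semicontinuous (subspace (D : set (weak H))) R (EFin \o f).

(* Main.v *)
Require Import Defs.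
From mathcomp Require Import all_boot all_order all_algebra.
From mathcomp Require Import all_classical all_reals all_analysis.
From mathcomp Require Import ring lra.

(** If some sphere carries a point [xs] satisfying the two inequalities, the
    second one at [y = 0] reads [dot (Phi 0) xs < 0], so [Phi 0 <> 0].

    Conversely, suppose [Phi 0 <> 0]. The first inequality says that [xs] is the
    strict minimizer of the linear form [dot (Phi xs)] on the ball of radius [r],
    that is, that [xs] is the antiradial point [- (r / `|Phi xs|) *: Phi xs]. So
    [xs] has to be a fixed point of the map [x |-> - (r / `|Phi x|) *: Phi x].
    The derivative of [Phi] is bounded on the ball of radius [rho]
    ([op_lipschitz_bounded]), hence [Phi] is Lipschitz on the open ball, with some
    constant [K] ([frechet_lipschitz_open_ball]), and its norm stays above
    [m = `|Phi 0| / 2] near 0. For small [r] the factor [r] then makes the map a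
    contraction, and it has a fixed point [xs] ([antiradial_fixpoint]).

    The minimum of [dot (Phi xs)] at [xs] is quadratically strict
    ([dot_antiradial_le]):
    [dot (Phi xs) (xs - y) <= - (`|Phi xs| / (2 * r)) * `|xs - y| ^+ 2].
    Replacing [Phi xs] by [Phi y] costs at most [K * `|xs - y| ^+ 2], and for
    small [r] the coefficient [`|Phi xs| / (2 * r)] exceeds [K]; this gives the
    second inequality. Uniqueness follows by playing the first inequality for one
    solution against the second inequality for the other. *)

Import Order.TTheory GRing.Theory Num.Theory.
Import numFieldNormedType.Exports.

Local Open Scope classical_set_scope.
Local Open Scope ring_scope.

(** * The inner product *)

Lemma dotC {R : realType} {H : lmodType R} {dot : {dot H for idfun}}
    (u v : H) : dot u v = dot v u.
Proof. by rewrite (hermitian_subproof (s := dot)) expr0 mul1r. Qed.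

Lemma dotZr {R : realType} {H : lmodType R} {dot : {dot H for idfun}}
    (a : R) (u v : H) : dot u (a *: v) = a * dot u v.
Proof. by rewrite linearZr_LR. Qed.

Lemma dotZl {R : realType} {H : lmodType R} {dot : {dot H for idfun}}
    (a : R) (u v : H) : dot (a *: u) v = a * dot u v.
Proof. by rewrite linearZl_LR. Qed.

Lemma dotBl {R : realType} {H : lmodType R} {dot : {dot H for idfun}}
    (u v w : H) : dot (u - v) w = dot u w - dot v w.
Proof. by rewrite linearBl. Qed.

Lemma dotBr {R : realType} {H : lmodType R} {dot : {dot H for idfun}}
    (u v w : H) : dot u (v - w) = dot u v - dot u w.
Proof. by rewrite linearBr. Qed.

Lemma sqr_normB {R : realType} {H : completeNormedModType R}
    {dot : {dot H for idfun}} (hdot : hilbert_dot dot)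
    (u v : H) : `|u - v| ^+ 2 = `|u| ^+ 2 - 2 * dot u v + `|v| ^+ 2.
Proof. by rewrite !hdot dotBl !dotBr (dotC v u); ring. Qed.

(** Cauchy-Schwarz: expand the square of [`|v| u - `|u| v]. *)
Lemma dot_le_norm {R : realType} {H : completeNormedModType R}
    {dot : {dot H for idfun}} (hdot : hilbert_dot dot)
    (u v : H) : dot u v <= `|u| * `|v|.
Proof.
have [->|u0] := eqVneq u 0; first by rewrite linear0l normr0 mul0r.
have [->|v0] := eqVneq v 0; first by rewrite linear0r normr0 mulr0.
have := sqr_ge0 `| `|v| *: u - `|u| *: v|.
rewrite (sqr_normB hdot) !normrZ !normr_id dotZl dotZr.
have : 0 < `|u| * `|v| by rewrite mulr_gt0 ?normr_gt0.
by nra.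
Qed.

Lemma norm_dot_le {R : realType} {H : completeNormedModType R}
    {dot : {dot H for idfun}} (hdot : hilbert_dot dot)
    (u v : H) : `|dot u v| <= `|u| * `|v|.
Proof.
rewrite ler_norml (dot_le_norm hdot) andbT lerNl -(linearNl dot).
by rewrite (le_trans (dot_le_norm hdot _ _))// normrN.
Qed.

(** Since [x] has norm [r >= `|y|], expanding [`|x - y| ^+ 2] gives
    [dot x (x - y) >= `|x - y| ^+ 2 / 2]; now [v] is [- (`|v| / r)] times [x].
    So [x] minimizes [dot v] on the ball, and by strict convexity the values
    elsewhere exceed the minimum by a quadratic amount, which is what absorbs the
    perturbation of [v = Phi x] into [Phi y]. *)
Lemma dot_antiradial_le {R : realType} {H : completeNormedModType R}
    {dot : {dot H for idfun}} (hdot : hilbert_dot dot)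
    (r : R) (v x y : H) :
  0 < r -> v != 0 -> x = - (r / `|v|) *: v -> `|y| <= r ->
  dot v (x - y) <= - (`|v| / (2 * r)) * `|x - y| ^+ 2.
Proof.
move=> r0 v0 xE yr.
have nv : 0 < `|v| by rewrite normr_gt0.
have nx : `|x| = r.
  by rewrite xE normrZ normrN gtr0_norm ?divr_gt0// divfK ?gt_eqF.
have -> : dot v (x - y) = - (`|v| / r) * dot x (x - y).
  by move: (x - y) => u; rewrite xE dotZl; field; rewrite !gt_eqF.
rewrite (sqr_normB hdot) dotBr -(hdot x) nx !mulNr lerN2.
rewrite invfM mulrA [_ * r^-1]mulrAC -[X in X <= _]mulrA.
rewrite ler_pM2l ?divr_gt0//.
have : `|y| ^+ 2 <= r ^+ 2 by rewrite lerXn2r ?nnegrE// ltW.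
by lra.
Qed.

(** * From derivative bounds to Lipschitz bounds *)

(** The scalar mean value theorem does not extend to [H]-valued maps, so it is
    applied to the component of [f] along [v = f y - f x] on the segment, which
    yields [`|v| ^+ 2 <= K * `|y - x| * `|v|]. *)
Lemma frechet_mvt_le {R : realType} {H : completeNormedModType R}
    {dot : {dot H for idfun}} (hdot : hilbert_dot dot)
    {V : normedModType R} (D : set V) (f : V -> H)
    (df : V -> {linear V -> H}) (K : R) (x y : V) :
  (forall t : R, 0 <= t <= 1 -> nbhs (x + t *: (y - x)) D) ->
  (forall z, D z -> is_frechet_within D f z (df z)) ->
  (forall z u, D z -> `|df z u| <= K * `|u|) ->
  `|f y - f x| <= K * `|y - x|.
Proof.
move=> segD fr bnd.
set w := y - x; set v := f y - f x.
pose z t := x + t *: w.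
pose g t := dot (f (z t)) v.
have gd (t : R) : 0 <= t <= 1 -> is_derive t 1 g (dot (df (z t) w) v).
  move=> t01.
  have zc h : z (t + h) = z t + h *: w by rewrite /z scalerDl addrA.
  suff cv : h^-1 *: (g (h *: 1 + t) - g t) @[h --> 0^'] --> dot (df (z t) w) v.
    by apply: DeriveDef; [apply/cvg_ex; eexists; exact: cv| exact: cvg_lim cv].
  apply/cvgrPdist_le => /= e e0.
  (* The 1 keeps the divisor positive when w or v vanishes. *)
  have c0 : 0 < 1 + `|w| * `|v| by rewrite ltr_pwDl// mulr_ge0.
  have Dz := nbhs_singleton (segD t t01).
  have [_ /(_ (e / (1 + `|w| * `|v|)))] := fr _ Dz.
  rewrite divr_gt0// => /(_ isT).
  have zcv : z t + h *: w @[h --> (0:R)] --> z t.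
    rewrite -[X in _ --> X](addr0) -[X in _ --> _ + X](scale0r w).
    by apply: cvgD; [exact: cvg_cst | apply: cvgZl; exact: cvg_id].
  rewrite near_withinE => nr.
  have /zcv := nr.
  have /zcv := segD t t01.
  rewrite !near_simpl /= => n1 n2.
  near=> h.
  have h0 : h != 0 by near: h; exact: nbhs_dnbhs_neq.
  have Dh : D (z t + h *: w) by near: h; exact: nbhs_dnbhs n1.
  have : D (z t + h *: w) ->
    `|f (z t + h *: w) - f (z t) - df (z t) (z t + h *: w - z t)|
      <= e / (1 + `|w| * `|v|) * `|z t + h *: w - z t|.
    by near: h; exact: nbhs_dnbhs n2.
  move=> /(_ Dh).
  rewrite [z t + _ - _]addrAC subrr add0r linearZ normrZ /= => est.
  rewrite /g /GRing.scale /= mulr1 (addrC h) zc -dotBl.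
  have -> : dot (df (z t) w) v - h^-1 * dot (f (z t + h *: w) - f (z t)) v
    = - h^-1 * dot (f (z t + h *: w) - f (z t) - h *: df (z t) w) v.
    by rewrite [in RHS]dotBl dotZl; field.
  rewrite normrM normrN normfV -ler_pdivlMl ?invr_gt0 ?normr_gt0// invrK.
  apply: le_trans (norm_dot_le hdot _ _) _.
  apply: le_trans (ler_wpM2r (normr_ge0 _) est) _.
  rewrite mulrC !mulrA [_ * `|h|]mulrC -!mulrA ler_pM2l ?normr_gt0//.
  rewrite mulrCA ger_pMr// mulrCA mulrC ler_pdivrMr// mul1r mulrC.
  by rewrite lerDr.
have [c c01] : exists2 c, c \in `[0, 1]%R &
    g 1 - g 0 = dot (df (z c) w) v * (1 - 0).
  apply: (@MVT_segment _ g (fun t => dot (df (z t) w) v)) => //.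
  - by move=> t; rewrite in_itv/= => /andP[t0 t1]; apply: gd; rewrite !ltW.
  - apply/continuous_in_subspaceT => t; rewrite inE/= in_itv/= => t01.
    by apply: differentiable_continuous; apply/derivable1_diffP; case: (gd t t01).
have -> : g 1 - g 0 = `|v| ^+ 2.
  by rewrite /g /z scale1r scale0r addr0 [x + w]addrC subrK -dotBl -hdot.
rewrite subr0 mulr1 => vE.
have [->|v0] := eqVneq v 0.
  rewrite normr0; apply: le_trans (bnd x w _); first exact: normr_ge0.
  by have := segD 0; rewrite lexx ler01 scale0r addr0 => /(_ isT) /nbhs_singleton.
rewrite -(ler_pM2r (_ : 0 < `|v|)) ?normr_gt0// -expr2 vE.
apply: le_trans (dot_le_norm hdot _ _) _; rewrite ler_wpM2r//; apply: bnd.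
by apply: nbhs_singleton; apply: segD; move: c01; rewrite in_itv.
Unshelve. all: by end_near. Qed.

(** Segments between points of the open ball stay in the interior of the closed
    one, where the derivative relative to the ball is the ordinary derivative. *)
Lemma frechet_lipschitz_open_ball {R : realType} {H : completeNormedModType R}
    {dot : {dot H for idfun}} (hdot : hilbert_dot dot)
    {V : normedModType R} (rho K : R) (f : V -> H)
    (df : V -> {linear V -> H}) (x y : V) :
  (forall z, Ball V rho z -> is_frechet_within (Ball V rho) f z (df z)) ->
  (forall z u, Ball V rho z -> `|df z u| <= K * `|u|) ->
  `|x| < rho -> `|y| < rho -> `|f x - f y| <= K * `|x - y|.
Proof.
move=> fr bnd xrho yrho.
apply: (@frechet_mvt_le _ _ _ hdot _ (Ball V rho) f df).
- move=> t /andP[t0 t1].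
  have pE : y + t *: (x - y) = (1 - t) *: y + t *: x.
    by rewrite scalerBr scalerBl scale1r addrA addrAC.
  have p_rho : `|y + t *: (x - y)| < rho.
    rewrite pE; apply: le_lt_trans (ler_normD _ _) _.
    rewrite !normrZ !ger0_norm ?subr_ge0//.
    have [->|tn0] := eqVneq t 0; first by rewrite subr0 mul1r mul0r addr0.
    have : t * `|x| < t * rho by rewrite ltr_pM2l// lt0r tn0.
    have : (1 - t) * `|y| <= (1 - t) * rho by rewrite ler_wpM2l ?subr_ge0// ltW.
    by lra.
  near=> z; rewrite /Ball/= ltW//; near: z.
  exact: cvgr_norm_lt (@cvg_id _ _) _ p_rho.
- exact: fr.
- by move=> z u; exact: bnd.
Unshelve. all: by end_near. Qed.

Lemma op_norm_ge {R : realType} {V W : normedModType R}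
    (A : {linear V -> W}) (x : V) :
  continuous A -> `|A x| <= op_norm A * `|x|.
Proof.
move=> /linear_bounded_continuous/linear_boundedP/pinfty_ex_gt0[M M0 AM].
have [->|x0] := eqVneq x 0; first by rewrite linear0 !normr0 mulr0.
have nx : 0 < `|x| by rewrite normr_gt0.
rewrite -ler_pdivrMr//.
have -> : `|A x| / `|x| = `|A (`|x|^-1 *: x)|.
  by rewrite linearZ normrZ normfV normr_id mulrC.
apply: ub_le_sup; last first.
  exists (`|x|^-1 *: x) => //=.
  by rewrite /Ball/= normrZ normfV normr_id mulVf ?gt_eqF.
exists M => _ [u /= u1 <-]; apply: le_trans (AM u) _.
by rewrite -[leRHS]mulr1 ler_pM2l.
Qed.

(** The ball has finite radius, so the Lipschitz bound compares every [df x] with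
    [df 0] at a uniformly bounded distance. *)
Lemma op_lipschitz_bounded {R : realType} {V W : normedModType R} (rho : R)
    (df : V -> {linear V -> W}) : 0 < rho ->
  (forall x, Ball V rho x -> continuous (df x)) ->
  op_lipschitz_on (Ball V rho) df ->
  exists2 K, 0 < K & forall x u, Ball V rho x -> `|df x u| <= K * `|u|.
Proof.
move=> rho0 dfc [L lip].
have B0 : Ball V rho 0 by rewrite /Ball/= normr0 ltW.
(* The final 1 makes the bound positive even if df vanishes. *)
exists (`|op_norm (df 0)| + `|L| * rho + 1).
  by rewrite ltr_wpDl// addr_ge0// mulr_ge0// ltW.
move=> x u Bx.
have dc : continuous (df x \- df 0) by move=> y; apply: cvgB; exact: dfc.
have e0 := op_norm_ge (df 0) u (dfc 0 B0).
have e1 := op_norm_ge (df x \- df 0) u dc.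
have l1 : op_norm (df x \- df 0) <= `|L| * rho.
  apply: le_trans (lip _ _ Bx B0) _; rewrite subr0.
  apply: le_trans (ler_wpM2r (normr_ge0 x) (ler_norm L)) _.
  exact: ler_wpM2l.
rewrite -[df x u](subrK (df 0 u)).
apply: le_trans (ler_normD _ _) _.
apply: le_trans (lerD e1 e0) _.
rewrite -mulrDl ler_wpM2r//.
by have := ler_norm (op_norm (df 0)); lra.
Qed.

(** * The fixed point *)

(** Write the difference as [(a - b) / `|a|] plus [b] times the difference of the
    inverse norms: both terms have norm at most [`|a - b| / `|a|]. *)
Lemma norm_normalizeB {R : realType} {V : normedModType R} (a b : V) :
  a != 0 -> b != 0 ->
  `| `|a|^-1 *: a - `|b|^-1 *: b| <= 2 / `|a| * `|a - b|.
Proof.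
move=> a0 b0.
have na : 0 < `|a| by rewrite normr_gt0.
have nb : 0 < `|b| by rewrite normr_gt0.
have -> : `|a|^-1 *: a - `|b|^-1 *: b
        = `|a|^-1 *: (a - b) + (`|a|^-1 - `|b|^-1) *: b.
  by rewrite scalerBr scalerBl addrA subrK.
apply: le_trans (ler_normD _ _) _.
have -> : `|(`|a|^-1 - `|b|^-1) *: b| = `|a|^-1 * `| `|a| - `|b| |.
  rewrite normrZ -[X in _ * X](gtr0_norm nb) -normrM.
  rewrite distrC -[X in X * `|_ - _|]gtr0_norm ?invr_gt0// -normrM.
  by congr (`| _ |); field; rewrite !gt_eqF.
rewrite normrZ normfV normr_id.
have := ler_dist_dist a b.
have : 0 < `|a|^-1 by rewrite invr_gt0.
by nra.
Qed.

(** The map [x |-> - (r / `|Phi x|) *: Phi x] sends the ball to its sphere. Its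
    Lipschitz constant is at most [r * (2 / m) * K], because normalizing vectors
    of norm at least [m] is [2 / m]-Lipschitz; the bound on [r] makes this at most
    1/2, and Banach's fixed point theorem applies. *)
Lemma antiradial_fixpoint {R : realType} {H : completeNormedModType R}
    (Phi : H -> H) (r m K : R) :
  0 < r -> 0 < m -> 0 < K -> 4 * K * r <= m ->
  (forall x, Ball H r x -> m <= `|Phi x|) ->
  (forall x y, Ball H r x -> Ball H r y -> `|Phi x - Phi y| <= K * `|x - y|) ->
  exists2 x, Sphere H r x & x = - (r / `|Phi x|) *: Phi x.
Proof.
move=> r0 m0 K0 Kr Phim PhiK.
pose f x := - (r / `|Phi x|) *: Phi x.
have nz x : Ball H r x -> Phi x != 0.
  by move=> /Phim; rewrite -normr_gt0; exact: lt_le_trans.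
have fS x : Ball H r x -> Sphere H r (f x).
  move=> Bx; rewrite /Sphere/= normrZ normrN gtr0_norm ?divfK ?normr_eq0 ?nz//.
  by rewrite divr_gt0 ?normr_gt0 ?nz.
have fB : set_fun (Ball H r) (Ball H r) f by move=> x /fS; rewrite /Ball/= => ->.
pose F : {fun Ball H r >-> Ball H r} := mkfun fB.
have [|||x Bx xE] := @banach_fixed_point _ _ _ F; last 1 first.
- by exists x => //; have := fS x Bx; rewrite -[f x]/(F x) -xE.
- have q0 : 0 <= 2^-1 :> R by lra.
  exists (NngNum q0); split=> /=; first by lra.
  move=> [x y] /= [Bx By].
  have -> : f x - f y = - r *: (`|Phi x|^-1 *: Phi x - `|Phi y|^-1 *: Phi y).
    by rewrite /f scalerBr !scalerA !mulNr.
  rewrite normrZ normrN gtr0_norm//.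
  have := norm_normalizeB _ _ (nz _ Bx) (nz _ By).
  rewrite -(ler_pM2l r0) => /le_trans; apply.
  have nx : 0 < `|Phi x| by rewrite normr_gt0 nz.
  rewrite mulrA [r * _]mulrA mulrAC ler_pdivrMr//.
  have := PhiK _ _ Bx By; rewrite -(ler_pM2l r0) => lip.
  have : 2^-1 * (4 * K * r) * `|x - y| <= 2^-1 * `|Phi x| * `|x - y|.
    by rewrite ler_wpM2r// ler_wpM2l// (le_trans Kr)// Phim.
  by lra.
- apply: (@closed_comp _ _ (fun x : H => `|x|) [set t | t <= r]).
    by move=> x _; exact: norm_continuous.
  exact: closed_le.
- by exists 0; rewrite /Ball/= normr0 ltW.
Qed.

(** * The equivalence *)

Theorem theorem2p3 (R : realType) (H : completeNormedModType R)
    (dot : {dot H for idfun}) (hdot : hilbert_dot dot)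
    (rho : R) (rho_gt0 : 0 < rho)
    (Phi : H -> H) (dPhi : H -> {linear H -> H})
    (Phi_C1 : C1_on (Ball H rho) Phi dPhi)
    (dPhi_lip : op_lipschitz_on (Ball H rho) dPhi)
    (Phi_wlsc : forall y : H, Ball H rho y ->
       weakly_lsc_on (Ball H rho) (fun x => dot (Phi x) (x - y))) :
  (exists2 r0 : R, r0 \in `]0, rho] &
     forall r : R, r \in `]0, r0] ->
       exists! xs : H, Sphere H r xs /\
         forall y : H, (Ball H r `\ xs) y ->
           Num.max (dot (Phi xs) (xs - y)) (dot (Phi y) (xs - y)) < 0)
  <-> Phi 0 <> 0.
Proof.
split=> [[r0 r0_itv /(_ r0)] | /eqP Phi0].
  have r0_gt0 : 0 < r0 by move: r0_itv; rewrite in_itv/= => /andP[].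
  rewrite in_itv/= r0_gt0 lexx => /(_ isT)[xs [[xsr xs_neg] _]] Phi0.
  have : (Ball H r0 `\ xs) 0.
    split; first by rewrite /Ball/= normr0 ltW.
    move=> /= xs0; move: xsr r0_gt0.
    by rewrite /Sphere/= -xs0 normr0 => <-; rewrite ltxx.
  by move=> /xs_neg; rewrite Phi0 (linear0l dot) gt_max ltxx andbF.
have [K K0 dPhiK] : exists2 K, 0 < K &
    forall x u, Ball H rho x -> `|dPhi x u| <= K * `|u|.
  by apply: op_lipschitz_bounded => // x /Phi_C1.1[].
have PhiK x y :=
  frechet_lipschitz_open_ball hdot rho K Phi dPhi x y Phi_C1.1 dPhiK.
set m := `|Phi 0| / 2.
have m0 : 0 < m by rewrite divr_gt0 ?normr_gt0.
(* rho / 2 keeps the ball inside the open one. m / (4 * K) keeps |Phi| above m,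
   makes the fixed-point map contract by 1/2, and makes the gain
   |Phi xs| / (2 r) beat the Lipschitz loss K. *)
exists (Num.min (rho / 2) (m / (4 * K))).
  rewrite in_itv/=; apply/andP; split.
    by rewrite lt_min divr_gt0//= divr_gt0// mulr_gt0.
  by apply: (@le_trans _ _ (rho / 2)); [rewrite ge_min lexx | lra].
move=> r; rewrite in_itv/= le_min => /andP[r0 /andP[r_rho]].
rewrite ler_pdivlMr ?mulr_gt0// mulrC => r_m.
have Brho x : Ball H r x -> `|x| < rho by rewrite /Ball/= => xr; lra.
have Phim x : Ball H r x -> m <= `|Phi x|.
  move=> Bx; have := PhiK 0 x.
  rewrite normr0 sub0r normrN => /(_ rho_gt0 (Brho _ Bx)).
  have := lerB_dist (Phi 0) (Phi x).
  have : K * `|x| <= K * r by rewrite ler_pM2l.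
  by rewrite /m in m0 r_m *; lra.
have PhiKr x y : Ball H r x -> Ball H r y -> `|Phi x - Phi y| <= K * `|x - y|.
  by move=> /Brho xr /Brho yr; exact: PhiK.
have [xs xsr xsE] := antiradial_fixpoint _ _ _ _ r0 m0 K0 r_m Phim PhiKr.
have Bxs : Ball H r xs by rewrite /Ball/= xsr.
have nPhi : 0 < `|Phi xs| by exact: lt_le_trans (Phim _ Bxs).
have xs_neg y : (Ball H r `\ xs) y ->
    Num.max (dot (Phi xs) (xs - y)) (dot (Phi y) (xs - y)) < 0.
  move=> [By /eqP/negPf y_xs].
  have nB : 0 < `|xs - y| by rewrite normr_gt0 subr_eq0 eq_sym y_xs.
  have neg : dot (Phi xs) (xs - y) <= - (`|Phi xs| / (2 * r)) * `|xs - y| ^+ 2.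
    by apply: (dot_antiradial_le hdot) => //; rewrite -normr_gt0.
  have neg0 : - (`|Phi xs| / (2 * r)) * `|xs - y| ^+ 2 < - K * `|xs - y| ^+ 2.
    rewrite ltr_pM2r ?exprn_gt0// ltrN2 ltr_pdivlMr ?mulr_gt0//.
    by have := Phim _ Bxs; have := mulr_gt0 K0 r0; lra.
  have K2 : 0 < K * `|xs - y| ^+ 2 by rewrite mulr_gt0 ?exprn_gt0.
  rewrite gt_max; apply/andP; split; first by lra.
  have : dot (Phi y - Phi xs) (xs - y) <= K * `|xs - y| ^+ 2.
    apply: le_trans (dot_le_norm hdot _ _) _.
    by rewrite expr2 mulrA ler_wpM2r// (distrC xs) PhiKr.
  by rewrite dotBl; lra.
(* Two solutions would give dot (Phi zs) (zs - xs) both signs: negative by the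
   first inequality for zs, positive by the second inequality for xs. *)
exists xs; split=> // zs [zsr zs_neg]; apply: contrapT => xs_zs.
have Bzs : Ball H r zs by rewrite /Ball/= zsr.
have : dot (Phi zs) (zs - xs) < 0.
  by have := zs_neg xs (conj Bxs xs_zs); rewrite gt_max => /andP[].
have : dot (Phi zs) (xs - zs) < 0.
  by have := xs_neg zs (conj Bzs (nesym xs_zs)); rewrite gt_max => /andP[].
by rewrite !dotBr; lra.
Qed.
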